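(* Let $\Lambda$ be a hereditary QF-$3^{+}$ ring. Then, for any projective modules $P$ and $Q$ and any homomorphism $f:P\to Q$, there is a unique homomorphism $f':I(P)\to I(Q)$ such that $f' i_P=i_Q f$, where $i_P:P\rightarrowtail I(P)$ and $i_Q:Q\rightarrowtail I(Q)$ are the embeddings into the injective envelopes.
   Context: Rings are associative with identity; modules are left unital $\Lambda$-modules; $I(M)$ denotes the injective envelope of $M$. A ring $\Lambda$ is left QF-$3^{+}$ if $I({}_\Lambda\Lambda)$ is projective, where ${}_\Lambda\Lambda$ is $\Lambda$ as a left module over itself; a left hereditary left QF-$3^{+}$ ring is also right hereditary and right QF-$3^{+}$, so one speaks of hereditary QF-$3^{+}$ rings. *)

(* Defs.v *)
From HB Require Import structures.
From mathcomp Require Import all_boot all_order all_algebra.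

Set Implicit Arguments.
Unset Strict Implicit.
Unset Printing Implicit Defensive.

Import GRing.Theory.
Local Open Scope ring_scope.

Section Modules.

Variable R : pzRingType.

Definition projective_module (P : lmodType R) : Prop :=
  forall (A B : lmodType R) (p : {linear A -> B}) (f : {linear P -> B}),
    (forall b : B, exists a : A, p a = b) ->
    exists g : {linear P -> A}, p \o g =1 f.

Definition injective_module (E : lmodType R) : Prop :=
  forall (A B : lmodType R) (j : {linear A -> B}) (f : {linear A -> E}),
    injective j ->
    exists g : {linear B -> E}, g \o j =1 f.

(* Every submodule of E meeting the image of j only in 0 is itself 0. *)
Definition essential_mono (M E : lmodType R) (j : {linear M -> E}) : Prop :=
  injective j /\
  forall N : submodClosed E,
    (forall m : M, j m \in N -> j m = 0) ->
    forall x : E, x \in N -> x = 0.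

(* E, together with j, is an injective envelope I(M) of M; this determines
   the pair (E, j) up to isomorphism under M. *)
Definition injective_envelope (M E : lmodType R) (j : {linear M -> E}) : Prop :=
  injective_module E /\ essential_mono j.

(* In the left module R^o the submodules are the left ideals of R; J ranges
   over the modules carried by the left ideal I. *)
Definition left_hereditary : Prop :=
  forall (I : submodClosed R^o) (J : subLmodType (I : {pred R^o})),
    projective_module J.

(* The choice of the injective envelope of R^o is immaterial, by uniqueness
   up to isomorphism. *)
Definition left_QF3plus : Prop :=
  exists (E : lmodType R) (j : {linear R^o -> E}),
    injective_envelope j /\ projective_module E.

(* A ring satisfying these left-handed conditions satisfies the right-handed
   ones as well. *)
Definition hereditary_QF3plus : Prop := left_hereditary /\ left_QF3plus.

End Modules.

(* Main.v *)
From HB Require Import structures.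
Require Import Defs.
From mathcomp Require Import all_boot all_order all_algebra.
From mathcomp Require Import boolp classical_sets functions.

(* Uniqueness amounts to: a map h : I(P) -> I(Q) killing P is 0.  Since Lambda
   is left hereditary, Baer's criterion shows that images of injective modules
   are injective.  Let E = I(Lambda), which is projective.  If k : I(P) -> E
   kills P, then im k is injective, hence a direct summand of E, hence
   projective; so ker k is a direct summand of I(P) that contains the essential
   submodule P, and k = 0.  If h were nonzero, its image would contain some
   nonzero q in Q.  As Q embeds in a free module, some Q -> Lambda does not kill
   q, and it extends to u : I(Q) -> E with u h <> 0, a contradiction. *)

Set Implicit Arguments.
Unset Strict Implicit.
Unset Printing Implicit Defensive.

Import GRing.Theory.
Local Open Scope ring_scope.

Section Submodules.

Variables (R : pzRingType) (M : lmodType R).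

Lemma submodule_of (S : M -> Prop) :
    S 0 -> (forall a u v, S u -> S v -> S (a *: u + v)) ->
  exists N : submodClosed M, forall x, x \in N <-> S x.
Proof.
move=> S0 SP; pose p : {pred M} := fun x => `[< S x >].
have pE x : x \in p <-> S x by split=> /asboolP.
have p_closed : submod_closed p.
  split=> [|a u v]; first exact/pE.
  by move=> /pE Su /pE Sv; apply/pE/SP.
pose N : submodClosed M :=
  HB.pack (p : M -> bool) (GRing.isSubmodClosed.Build R M p p_closed).
by exists N.
Qed.

Variable N : submodClosed M.

Definition submod : Type := {x : M | x \in N}.

HB.instance Definition _ := [isSub of submod for @sval M (fun x => x \in N)].
HB.instance Definition _ := [Choice of submod by <:].
HB.instance Definition _ := [SubChoice_isSubLmodule of submod by <:].

End Submodules.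

(** Two values over one [x] differ by a value over 0, so the condition at 0 makes [G] single-valued.
    Choice then yields a function, linear because its values are unique. *)
Lemma linear_of_graph (R : pzRingType) (A B : lmodType R) (G : A -> B -> Prop) :
    (forall x, exists y, G x y) ->
    (forall a x y x' y', G x y -> G x' y' -> G (a *: x + x') (a *: y + y')) ->
    (forall y, G 0 y -> y = 0) ->
  exists g : {linear A -> B}, forall x, G x (g x).
Proof.
move=> Gtot GP G0.
have Gfun x y y' : G x y -> G x y' -> y = y'.
  move=> Gy Gy'; apply/eqP; rewrite -subr_eq0; apply/eqP/G0.
  by have := GP (-1) _ _ _ _ Gy' Gy; rewrite !scaleN1r addNr addrC.
have [g Gg] := choice Gtot.
have g_lin : linear g by move=> a x x'; apply: (Gfun _ _ _ (Gg _)); exact: GP.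
pose g' : {linear A -> B} :=
  HB.pack g (GRing.isLinear.Build R A B *:%R g g_lin).
by exists g'.
Qed.

Section Baer.

Variables (R : pzRingType) (M : lmodType R).

Definition baer_module : Prop :=
  forall (I : submodClosed R^o) (f : {linear submod I -> M}),
  exists m : M, forall x : submod I, f x = (val x : R) *: m.

(** Zorn's lemma gives a maximal graph [G] of a linear extension of [f] to a part of [B]; Baer's
    condition forces its domain to be all of [B]. *)
Lemma baer_injective : baer_module -> injective_module M.
Proof.
move=> baerM A B j f j_inj.
pose good (G : set (B * M)) := [/\ forall x, G (j x, f x),
  forall a u v, G u -> G v -> G (a *: u + v) & forall m, G (0, m) -> m = 0].
(* The guard makes P hold of the empty set, the union of the empty chain. *)
pose P G := (exists u, G u) -> good G.
have [|G [PG Gmax]] := @Zorn_bigcup (B * M)%type P.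
  move=> F FP Ftot [u [X FX Xu]]; split=> [x|a v w|m].
  - by exists X => //; have [] := FP _ FX (ex_intro _ u Xu).
  - move=> [Y FY Yv] [Z FZ Zw]; have [YZ|ZY] := Ftot _ _ FY FZ.
    + exists Z => //; have [_ ZP _] := FP _ FZ (ex_intro _ w Zw).
      by apply: ZP => //; exact: YZ.
    + exists Y => //; have [_ YP _] := FP _ FY (ex_intro _ v Yv).
      by apply: YP => //; exact: ZY.
  - move=> [Y FY Y0]; have [_ _] := FP _ FY (ex_intro _ _ Y0).
    exact.
have goodG : good G.
  apply: PG; apply: contrapT => G_empty.
  (* The graph of [f] on the image of [j] is a good set strictly above the empty one. *)
  apply: (Gmax [set u | exists x, u = (j x, f x)]%classic).
    split=> [|/(_ (j 0, f 0))]; first by move=> u Gu; case: G_empty; exists u.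
    by move=> sub; apply: G_empty; exists (j 0, f 0); apply: sub; exists 0.
  move=> _; split=> [x|a u v [x ->] [y ->]|m [x [jx0 ->]]]; first by exists x.
    by exists (a *: x + y); rewrite !linearP.
  by rewrite (j_inj x 0) ?linear0.
have [Gf GP G0] := goodG.
have Gzero : G (0, 0) by have := Gf 0; rewrite !linear0.
have GN b m : G (b, m) -> G (- b, - m).
  by move=> /(GP (-1))/(_ Gzero); rewrite scaleN1r addr0.
have Gtot b : exists m, G (b, m).
  (* The left ideal of all [r] that carry [b] into the domain of [G]. *)
  have [||I memI] := @submodule_of R R^o (fun r : R => exists m, G (r *: b, m)).
  - by exists 0; rewrite scale0r.
  - move=> a r s [m Gm] [n Gn]; exists (a *: m + n).
    by have := GP a _ _ Gm Gn; rewrite scalerDl -scalerA.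
  have [|||phi Gphi] :=
    @linear_of_graph R (submod I) M (fun r m => G ((val r : R) *: b, m)).
  - by move=> r; apply/memI; exact: (valP r).
  - move=> a r m s n Gm Gn; rewrite linearP /= scalerDl -scalerA.
    exact: GP _ _ _ Gm Gn.
  - by move=> m; rewrite linear0 scale0r; exact: G0.
  have [m phiE] := baerM I phi; exists m.
  (* [G'] enlarges [G] by sending [b] to [m]; maximality then puts [(b, m)] in [G]. *)
  pose G' (u : B * M) := exists (r : R) v, G v /\ u = r *: (b, m) + v.
  have GG' : (G `<=` G')%classic.
    by move=> u Gu; exists 0, u; rewrite scale0r add0r.
  have G'bm : G' (b, m) by exists 1, (0, 0); rewrite scale1r addr0.
  apply: contrapT => nGbm; apply: (Gmax G').
    by split=> // /(_ _ G'bm).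
  move=> _; split=> [x|a u v [r [u' [Gu ->]]] [s [v' [Gv ->]]]|n].
  - exact: GG'.
  - exists (a * r + s), (a *: u' + v'); split; first exact: GP.
    by rewrite !scalerDr scalerDl scalerA addrACA.
  - move=> [r [[y k] [Gyk /= []]]] /esym/eqP; rewrite addr_eq0 => /eqP rb ->.
    (* [G] sends [r *: b = - y] both to [- k] and to [r *: m], whence [r *: m + k = 0]. *)
    have rI : r \in I by apply/memI; exists (- k); rewrite rb; exact: GN.
    have := Gphi (exist _ r rI); rewrite phiE /= rb => Grm.
    by apply: G0; have := GP 1 _ _ Grm Gyk; rewrite scale1r -(addNr y).
have [g Gg] := linear_of_graph Gtot (fun a x y x' y' => GP a (x, y) (x', y')) G0.
exists g => x /=; apply/eqP; rewrite -subr_eq0; apply/eqP/G0.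
rewrite addrC -(addNr (j x)).
by have := GP (-1) _ _ (Gf x) (Gg (j x)); rewrite scaleN1r.
Qed.

End Baer.

(** A map from a left ideal to [M] lifts to [E] because the ideal is projective, and the lift
    extends to the whole ring because [E] is injective. The image of 1 in [M] is the element Baer's
    criterion asks for. *)
Lemma hereditary_injective_image (R : pzRingType) (E M : lmodType R)
    (h : {linear E -> M}) :
  left_hereditary R -> injective_module E ->
  (forall m, exists x, h x = m) -> injective_module M.
Proof.
move=> hered injE h_surj; apply: baer_injective => I f.
have [g hg] := hered I (submod I) _ _ h f h_surj.
have [psi psiE] := injE (submod I) R^o (\val : {linear submod I -> R^o}) g val_inj.
exists (h (psi 1)) => x.
by rewrite -hg /= -psiE /= -!linearZ /= /GRing.scale /= mulr1.
Qed.

Lemma image_factor (R : pzRingType) (X Y : lmodType R) (h : {linear X -> Y}) :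
  exists (D : submodClosed Y) (k : {linear X -> submod D}),
    (forall x, val (k x) = h x) /\ (forall d, exists x, k x = d).
Proof.
have [||D memD] := @submodule_of R Y (fun y => exists x, h x = y).
- by exists 0; rewrite linear0.
- by move=> a _ _ [x <-] [x' <-]; exists (a *: x + x'); rewrite linearP.
exists D.
have [|||k kE] := @linear_of_graph R X (submod D) (fun x d => val d = h x).
- move=> x; have hD : h x \in D by apply/memD; exists x.
  by exists (exist _ (h x) hD).
- by move=> a x y x' y' ey ey'; rewrite !linearP /= ey ey'.
- by move=> y; rewrite linear0 => y0; apply: val_inj; rewrite y0 linear0.
exists k; split=> // d; have /memD [x hx] := valP d.
by exists x; apply: val_inj; rewrite kE.
Qed.

Lemma retract_projective (R : pzRingType) (E D : lmodType R)
    (i : {linear D -> E}) (r : {linear E -> D}) :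
  r \o i =1 id -> projective_module E -> projective_module D.
Proof.
move=> ri projE A B p f p_surj.
have [g pg] := projE _ _ p (f \o r : {linear E -> B}) p_surj.
exists (g \o i : {linear D -> A}) => d /=.
by have := pg (i d) => /= ->; have := ri d => /= ->.
Qed.

Lemma hereditary_eq0_of_essential (R : pzRingType) (P IP E : lmodType R)
    (iP : {linear P -> IP}) (k : {linear IP -> E}) :
  left_hereditary R -> injective_envelope iP -> projective_module E ->
  k \o iP =1 (fun=> 0) -> k =1 (fun=> 0).
Proof.
move=> hered [injIP [_ iP_ess]] projE kP0.
have [D [k' [k'E k'_surj]]] := image_factor k.
have injD := hereditary_injective_image hered injIP k'_surj.
have [r ri] := injD _ _ (\val : {linear submod D -> E})
  (idfun : {linear submod D -> submod D}) val_inj.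
have projD := retract_projective ri projE.
have [s k's] := projD _ _ k' (idfun : {linear submod D -> submod D}) k'_surj.
(* The image of the section [s] is a complement of the kernel of [k']. It meets the image of [iP]
   only in 0, since [k'] kills that image, so it vanishes by essentiality. *)
have [||N memN] := @submodule_of R IP (fun x => exists d, s d = x).
- by exists 0; rewrite linear0.
- by move=> a _ _ [x <-] [x' <-]; exists (a *: x + x'); rewrite linearP.
have s0 d : s d = 0.
  apply: (iP_ess N); last by apply/memN; exists d.
  move=> m /memN [c sc]; have c0 : c = 0.
    have := k's c; rewrite /= sc => <-; apply: val_inj.
    by rewrite k'E; exact: kP0.
  by rewrite -sc c0 linear0.
by move=> x; rewrite -k'E -[k' x]k's /= s0 !linear0.
Qed.

(* A stands for the free module on Q together with its map to Q: it consists of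
   the pairs (a, y) where a : Q -> R is finitely supported and
   y = \sum_x a x *: x.  Projecting on y makes Q a quotient of A, and a = 0
   forces y = 0. *)
Lemma projective_torsionless (R : pzRingType) (Q : lmodType R) (q : Q) :
  projective_module Q -> q <> 0 -> exists phi : {linear Q -> R^o}, phi q <> 0.
Proof.
move=> projQ q0.
pose F : lmodType R := (Q -> R^o : lmodType R).
pose S (u : (F * Q)%type) := exists s : seq Q,
  [/\ uniq s, forall x, x \notin s -> u.1 x = 0
    & u.2 = \sum_(x <- s) (u.1 x : R) *: x].
(* Lets the combinations of two elements be added over a common list. *)
have widen (a : Q -> R) (s t : seq Q) : uniq s -> uniq t -> {subset s <= t} ->
    (forall x, x \notin s -> a x = 0) ->
    \sum_(x <- s) a x *: x = \sum_(x <- t) a x *: x.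
  move=> us ut st a0; rewrite [RHS](bigID (mem s)) /= [X in _ + X]big1.
    rewrite addr0 -[RHS]big_filter; apply: perm_big; apply: uniq_perm => //.
      exact: filter_uniq.
    move=> x; rewrite mem_filter /=.
    by case: (boolP (x \in s)) => //= /st ->.
  by move=> x /a0 ->; rewrite scale0r.
have [||A memA] := @submodule_of R (F * Q)%type S.
- by exists [::]; split=> //; rewrite big_nil.
- move=> c [a y] [b z] [s [us /= a0 ->]] [t [ut /= b0 ->]].
  pose w := undup (s ++ t); have uw : uniq w by exact: undup_uniq.
  have sw : {subset s <= w} by move=> x xs; rewrite mem_undup mem_cat xs.
  have tw : {subset t <= w} by move=> x xt; rewrite mem_undup mem_cat xt orbT.
  exists w; split=> // [x xw|] /=.
    have -> : (c *: a + b) x = c *: (a x : R^o) + b x by [].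
    rewrite a0 ?b0 ?scaler0 ?addr0 //; first by apply: contra xw => /tw.
    by apply: contra xw => /sw.
  rewrite (widen _ _ _ us uw sw a0) (widen _ _ _ ut uw tw b0).
  rewrite scaler_sumr -big_split; apply: eq_bigr => x _ /=.
  by rewrite scalerA -scalerDl.
have A_surj y : exists u : submod A, (val u).2 = y.
  have deltaA : ((fun x => (x == y)%:R) : F, y) \in A.
    apply/memA; exists [:: y]; split=> //= [x|]; first by rewrite inE => /negPf->.
    by rewrite big_seq1 eqxx scale1r.
  by exists (exist (fun u => u \in A) _ deltaA).
have [g gE] := projQ _ _ (snd \o \val : {linear submod A -> Q})
  (idfun : {linear Q -> Q}) A_surj.
(* If all coordinates of [g q] vanished, so would the combination they define, which is [q]. The
   functional sought is a coordinate of [g]. *)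
have [x gqx] : exists x, (val (g q)).1 x <> 0.
  apply: contrapT => gq0; have /memA [s [_ _ gqE]] := valP (g q).
  apply: q0; have /= <- := gE q; rewrite gqE big1 // => x _.
  suff -> : (val (g q)).1 x = 0 by rewrite scale0r.
  by apply: contrapT => gqx; apply: gq0; exists x.
pose phi (y : Q) : R^o := (val (g y)).1 x.
have phi_lin : linear phi by move=> a y z; rewrite /phi !linearP.
pose phi' : {linear Q -> R^o} :=
  HB.pack phi (GRing.isLinear.Build R Q R^o *:%R phi phi_lin).
by exists phi'.
Qed.

Theorem proposition4p4 (Lambda : pzRingType)
    (hLambda : hereditary_QF3plus Lambda)
    (P Q IP IQ : lmodType Lambda)
    (hP : projective_module P) (hQ : projective_module Q)
    (iP : {linear P -> IP}) (hiP : injective_envelope iP)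
    (iQ : {linear Q -> IQ}) (hiQ : injective_envelope iQ)
    (f : {linear P -> Q}) :
  exists f' : {linear IP -> IQ},
    f' \o iP =1 iQ \o f /\
    forall g : {linear IP -> IQ}, g \o iP =1 iQ \o f -> g =1 f'.
Proof.
have [hered [E [j [[injE [j_inj _]] projE]]]] := hLambda.
have [injIQ [iQ_inj iQ_ess]] := hiQ.
have [iP_inj _] := hiP.2.
have [f' f'E] := injIQ _ _ iP (iQ \o f : {linear P -> IQ}) iP_inj.
exists f'; split=> // g gE.
pose h : {linear IP -> IQ} := g \- f'.
have hP0 x : h (iP x) = 0.
  by rewrite /h /=; have := gE x; have := f'E x => /= -> ->; rewrite subrr.
suff h0 x : h x = 0 by move=> x; apply/eqP; rewrite -subr_eq0; apply/eqP/h0.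
(* By essentiality of [iQ], it suffices that the image [D] of [h] meets that of [iQ] only in 0. *)
have [D [k [kE k_surj]]] := image_factor h.
rewrite -kE; apply: (iQ_ess D); last exact: (valP (k x)).
move=> q qD; apply: contrapT => iq0.
have q0 : q <> 0 by move=> q0; apply: iq0; rewrite q0 linear0.
have [phi phiq] := projective_torsionless hQ q0.
have [u uE] := injE _ _ iQ (j \o phi : {linear Q -> E}) iQ_inj.
have uh0 := @hereditary_eq0_of_essential _ _ _ _ iP (u \o h : {linear IP -> E})
  hered hiP projE.
(* With [h y = iQ q], the value [u (h y)] is [j (phi q)], yet [u \o h] is 0. *)
have [y ky] := k_surj (exist _ (iQ q) qD).
apply: phiq; apply: j_inj; rewrite linear0.
have := uE q => /= <-; have <- : h y = iQ q by rewrite -kE ky.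
by apply: uh0 => z; rewrite -[LHS]/(u (h (iP z))) hP0 linear0.
Qed.
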